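(* Suppose $n,k$ are positive integers with $2\le k\le \sqrt n$. There exists a universal constant $c>0$ such that, for any integer $D\ge 1$, $$\inf_{\widehat M\in\mathbb R[A]^{n\times n}_{\le D}}\ \sup_{M\in\mathcal M_k}\ \mathbb E\big(\ell(\widehat M,M)\big)\ \ge\ \frac{ck}{nD^4}.$$
   Context: $[k]=\{1,\dots,k\}$. The stochastic block model (SBM) class is $$\mathcal M_k=\{M\in[0,1]^{n\times n}: M_{ii}=0\ (i\in[n]),\ M_{ij}=M_{ji}=Q_{z_iz_j}\ (i\ne j)\ \text{for some } Q=Q^\top\in[0,1]^{k\times k},\ z\in[k]^n\}.$$ Given $M$, one observes a symmetric adjacency matrix $A\in\{0,1\}^{n\times n}$ with $A_{ii}=0$ and $A_{ij}=A_{ji}\sim\mathrm{Bernoulli}(M_{ij})$ independent over $1\le i<j\le n$; $\mathbb E$ is over $A$ given $M$. The loss is $\ell(\widehat M,M)=\binom n2^{-1}\sum_{1\le i<j\le n}(\widehat M_{ij}-M_{ij})^2$. The notation $\widehat M\in\mathbb R[A]^{n\times n}_{\le D}$ means that for all $(i,j)\in[n]\times[n]$, $\widehat M_{ij}$ is a real polynomial of degree at most $D$ in the entries of $A$. ''Universal'' means not depending on $n,k,D$. *)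

(* Defs.v *)
From HB Require Import structures.
From mathcomp Require Import all_boot all_order all_algebra.
From mathcomp Require Import all_classical all_reals all_analysis.
(* The notations of mpoly clash with those of MathComp-Analysis. *)
From mathcomp Require Import -(notations) mpoly.

Set Implicit Arguments.
Unset Strict Implicit.
Unset Printing Implicit Defensive.

Import Order.TTheory GRing.Theory Num.Theory.

Local Open Scope classical_set_scope.
Local Open Scope ring_scope.

Definition SBM (R : realType) (n k : nat) : set 'M[R]_n :=
  [set M |
    (forall i j, 0 <= M i j <= 1) /\
    (forall i, M i i = 0) /\
    exists (Q : 'M[R]_k) (z : 'I_n -> 'I_k),
      [/\ Q = Q^T,
          forall a b, 0 <= Q a b <= 1 &
          forall i j, i != j -> M i j = Q (z i) (z j) /\ M j i = Q (z i) (z j)]].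
Arguments SBM : clear implicits.

Definition is_adjacency (n : nat) (A : 'M[bool]_n) : bool :=
  (A^T == A) && [forall i, ~~ A i i].

(* The joint law of the observation: the entries above the diagonal are
   independent Bernoulli variables, which determine A by symmetry. *)
Definition adjacency_pmf (R : realType) (n : nat) (M : 'M[R]_n)
    (A : 'M[bool]_n) : R :=
  if is_adjacency A
  then \prod_(i < n) \prod_(j < n | (i < j)%N) bernoulli_pmf (M i j) (A i j)
  else 0.

Definition expect (R : realType) (n : nat) (M : 'M[R]_n)
    (f : 'M[bool]_n -> R) : R :=
  \sum_(A : 'M[bool]_n) adjacency_pmf M A * f A.

Definition loss (R : realType) (n : nat) (Mhat M : 'M[R]_n) : R :=
  ('C(n, 2)%:R)^-1 *
  \sum_(i < n) \sum_(j < n | (i < j)%N) (Mhat i j - M i j) ^+ 2.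

(* Polynomials in the entries of an n x n matrix have n * n variables, the
   variable of index mxvec_index i j standing for the (i, j) entry. *)
Definition poly_estimator (R : realType) (n : nat) : Type :=
  'M[mpoly (n * n) R]_n.

(* mmeasure mdeg (msize in the notation of mpoly) is the total degree plus one, and 0 for the zero polynomial. *)
Definition degree_le (R : realType) (n D : nat) : set (poly_estimator R n) :=
  [set Mhat | forall i j, (mmeasure mdeg (Mhat i j) <= D.+1)%N].
Arguments degree_le : clear implicits.

Definition estimate (R : realType) (n : nat) (Mhat : poly_estimator R n)
    (A : 'M[bool]_n) : 'M[R]_n :=
  let a : 'M[R]_n := map_mx (fun b : bool => b%:R) A in
  \matrix_(i, j) meval (fun l => mxvec a 0 l) (Mhat i j).

Definition risk (R : realType) (n : nat) (Mhat : poly_estimator R n)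
    (M : 'M[R]_n) : R :=
  expect M (fun A => loss (estimate Mhat A) M).

Definition minimax_risk (R : realType) (n k D : nat) : \bar R :=
  ereal_inf [set ereal_sup [set (risk Mhat M)%:E | M in SBM R n k]
            | Mhat in degree_le R n D].

(* Main.v *)
(* Put on M the prior M_ij = 1/4 + lam 1{z_i = z_j} (i <> j) with uniform labels z
   and lam = k / (32 D^2 sqrt n), and fix a pair e0. If a function u(A, z)
   satisfies E[u f] = E[x f] for all polynomials f of degree at most D in A, where
   x = M_e0 - 1/4, then
     E (f - x)^2 = E (f - u)^2 + E x^2 - E u^2 >= E x^2 - E u^2 = lam^2/k - E u^2.
   With X_e = M_e - 1/4, such a u is
     sum_S kappa_S prod_(e in S) (A_e - M_e) / (M_e (1 - M_e)),  |S| <= D,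
   where kappa_S is the joint cumulant of x and the X_e, e in S; its summands are
   orthogonal given z, so E u^2 <= sum_S kappa_S^2 (16/3)^|S|.
   By independence of the labels kappa_S vanishes unless e0 + S is connected, and
   |kappa_S| <= (|S|+1)^|S| lam^(|S|+1) k^(1-v), v the number of vertices of e0 + S.
   Growing S one edge at a time, each edge costs a factor of order D^2 lam^2
   (both ends already reached) or D n lam^2 / k^2 (one new vertex), so the sum over
   S is geometric, at most (3/2) lam^2 / k^2 <= (3/4) lam^2 / k. *)
Require Import Defs.
From mathcomp Require Import all_boot all_order all_algebra.
From mathcomp Require Import all_classical all_reals all_analysis.
From mathcomp Require Import -(notations) mpoly.
From mathcomp Require Import ring lra zify.
(* all_classical shadows the finite-set lemmas. *)
From mathcomp Require Import fintype finset.
Import Order.TTheory GRing.Theory Num.Theory.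
Local Open Scope ring_scope.

Set Implicit Arguments.
Unset Strict Implicit.
Unset Printing Implicit Defensive.

(** * Uniform labels *)

Section UniformLabels.
Variables (R : realFieldType) (I K : finType).
Hypothesis K_gt0 : (0 < #|K|)%N.
Local Notation label := {ffun I -> K}.
Implicit Types (f g : label -> R) (V : {set I}) (z : label).

Definition unif f : R := (#|{: label}|%:R)^-1 * \sum_z f z.

Lemma card_label_neq0 : #|{: label}|%:R != 0 :> R.
Proof. by rewrite pnatr_eq0 card_ffun expn_eq0 negb_and -lt0n K_gt0. Qed.

Lemma eq_unif f g : f =1 g -> unif f = unif g.
Proof. by move=> fg; congr (_ * _); apply: eq_bigr => z _; apply: fg. Qed.

Lemma unif_cst (a : R) : unif (fun=> a) = a.
Proof.
by rewrite /unif sumr_const -[a *+ _]mulr_natl mulKf // card_label_neq0.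
Qed.

Lemma unifZ (a : R) f : unif (fun z => a * f z) = a * unif f.
Proof. by rewrite /unif -mulr_sumr mulrCA. Qed.

Lemma unif_sum (J : Type) (r : seq J) (P : pred J) (F : J -> label -> R) :
  unif (fun z => \sum_(j <- r | P j) F j z) = \sum_(j <- r | P j) unif (F j).
Proof. by rewrite /unif exchange_big mulr_sumr. Qed.

Lemma unifD f g : unif (fun z => f z + g z) = unif f + unif g.
Proof. by rewrite /unif big_split mulrDr. Qed.

Lemma ler_unif f g : (forall z, f z <= g z) -> unif f <= unif g.
Proof.
by move=> fg; rewrite ler_wpM2l ?invr_ge0 ?ler0n //; apply: ler_sum => z _.
Qed.

Lemma unif_ge0 f : (forall z, 0 <= f z) -> 0 <= unif f.
Proof. by move=> f0; rewrite -[leLHS](unif_cst 0); apply: ler_unif. Qed.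

(** Passes from an average over the prior to the worst case: any lower bound on the Bayes risk is
    reached at some labelling. *)
Lemma unif_exists f (a : R) : a <= unif f -> exists z, a <= f z.
Proof.
move=> af; apply/existsP; rewrite -[X in is_true X]negbK; apply/negP.
move/existsPn => fa.
suff : unif f < a by rewrite ltNge af.
rewrite -[ltRHS]unif_cst /unif ltr_pM2l; last first.
  by rewrite invr_gt0 lt0r card_label_neq0 ler0n.
apply: ltr_sum => [|z _]; last by rewrite ltNge fa.
apply/hasP; have [c _] := card_gt0P K_gt0.
by exists [ffun=> c]; rewrite // mem_index_enum.
Qed.

Definition local V f := forall z z', {in V, z =1 z'} -> f z = f z'.

Lemma local_cst V (a : R) : local V (fun=> a).
Proof. by []. Qed.

Lemma localS V V' f : V \subset V' -> local V f -> local V' f.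
Proof. by move=> /subsetP VV' fV z z' zz'; apply: fV => i /VV'/zz'. Qed.

Lemma localM V f g : local V f -> local V g -> local V (fun z => f z * g z).
Proof. by move=> fV gV z z' zz'; rewrite (fV z z') // (gV z z'). Qed.

(** Take two independent copies of the labels and exchange their coordinates outside [V]. This
    involution preserves the uniform law on pairs, fixes the value of [f] at the first copy, and
    turns [g] of the second copy into [g] of the first. *)
Lemma unif_indep V f g : local V f -> local (~: V) g ->
  unif (fun z => f z * g z) = unif f * unif g.
Proof.
move=> fV gV; rewrite /unif mulrACA -invfM.
pose mix (p : label * label) : label :=
  [ffun i => if i \in V then p.1 i else p.2 i].
pose swap p := (mix p, mix (p.2, p.1)).
have swapK : involutive swap.
  move=> [z z']; rewrite /swap /mix /=; congr (_, _); apply/ffunP => i;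
    by rewrite !ffunE; case: (i \in V).
rewrite big_distrlr pair_big /=.
have -> : \sum_(p : label * label) f p.1 * g p.2 =
  \sum_(p : label * label) f p.1 * g p.1.
  rewrite (reindex swap) /=; last by exists swap => p _; rewrite swapK.
  apply: eq_bigr => -[z z'] _ /=; congr (_ * _).
    by apply: fV => i iV; rewrite !ffunE iV.
  by apply: gV => i; rewrite inE => /negbTE iV; rewrite !ffunE /= iV.
rewrite -(pair_big xpredT xpredT (fun z (_ : label) => f z * g z)) /=.
under [in RHS]eq_bigr do rewrite sumr_const -mulr_natr.
by rewrite -mulr_suml invfM mulrACA -mulrA mulVf ?card_label_neq0 ?mulr1 // mulrC.
Qed.

Lemma unif_pin (u : I) (c : K) : unif (fun z => (z u == c)%:R) = #|K|%:R^-1.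
Proof.
pose F i (a : K) : R := if i == u then (a == c)%:R else 1.
(* Written as a product over all coordinates, trivial away from [u], the indicator has a sum over
   labellings that factors. *)
have -> : unif (fun z => (z u == c)%:R) = unif (fun z => \prod_i F i (z i)).
  apply: eq_unif => z; rewrite (bigD1 u) //= /F eqxx big1 ?mulr1 // => i.
  by move=> /negbTE ->.
rewrite /unif -(bigA_distr_bigA F) (bigD1 u) //= {1}/F eqxx.
rewrite (bigD1 c) //= eqxx big1 ?addr0 ?mul1r; last by move=> a /negbTE ->.
have -> : \prod_(i | i != u) \sum_a F i a = #|K|%:R ^+ #|I|.-1.
  under eq_bigr => i /negbTE iu do
    (under eq_bigr do rewrite /F iu); rewrite ?sumr_const.
  by rewrite prodr_const -(cardC1 u).
have -> : #|{: label}|%:R = #|K|%:R * #|K|%:R ^+ #|I|.-1 :> R.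
  rewrite card_ffun -exprS prednK ?natrX //; apply/card_gt0P; by exists u.
by rewrite invfM mulfVK // expf_neq0 // pnatr_eq0 -lt0n.
Qed.

(** Split over the common label [c]: the label of [u] is uniform and independent of everything else
    in the integrand. This is the source of the factor 1/k paid by each new vertex. *)
Lemma unif_match (y u : I) f : y != u -> local (~: [set u]) f ->
  unif (fun z => f z * (z y == z u)%:R) = unif f / #|K|%:R.
Proof.
move=> yu fu.
have -> : unif (fun z => f z * (z y == z u)%:R) =
    unif (fun z => \sum_c (f z * (z y == c)%:R) * (z u == c)%:R).
  apply: eq_unif => z; rewrite (bigD1 (z u)) //= eqxx mulr1 big1 ?addr0 //.
  by move=> c; rewrite eq_sym => /negbTE ->; rewrite mulr0.
rewrite unif_sum.
under eq_bigr => c _.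
  rewrite (@unif_indep (~: [set u])) ?unif_pin; last 2 first.
  - apply: localM => // z z' zz'; rewrite zz' //; first by rewrite !inE.
  - by rewrite setCK => z z' zz'; rewrite zz' // inE.
  over.
rewrite -mulr_suml -unif_sum; congr (_ / _); apply: eq_unif => z.
rewrite (bigD1 (z y)) //= eqxx mulr1 big1 ?addr0 // => c.
by rewrite eq_sym => /negbTE ->; rewrite mulr0.
Qed.

End UniformLabels.

(** * Cumulants *)

Lemma prodrD_subsets (R : comPzSemiRingType) (E : finType) (T : {set E})
    (a b : E -> R) :
  \prod_(e in T) (a e + b e) =
  \sum_(S : {set E} | S \subset T) \prod_(e in S) a e * \prod_(e in T :\: S) b e.
Proof.
rewrite big_mkcond /=.
under eq_bigr => e _.
  have -> : (if e \in T then a e + b e else 1) =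
      (if e \in T then a e else 0) + (if e \in T then b e else 1).
    by case: ifP; rewrite ?add0r.
  over.
rewrite bigA_distr (bigID (fun S : {set E} => S \subset T)) /= addrC big1.
  rewrite add0r; apply: eq_bigr => S ST; rewrite (bigID (mem S)) /=.
  congr (_ * _).
    by apply: eq_bigr => e eS; rewrite eS (subsetP ST).
  rewrite [LHS]big_mkcond [RHS]big_mkcond; apply: eq_bigr => e _.
  by rewrite inE; case: (e \in S); case: (e \in T).
move=> S /subsetPn[e eS eT]; rewrite (bigD1 e) //= eS (negbTE eT).
by rewrite mul0r.
Qed.

Section Cumulants.
Variables (R : realFieldType) (E : finType) (mom tgt : {set E} -> R).
Implicit Types S T : {set E}.

(** The argument [m] is fuel: the recursion descends to proper subsets, so every [m] above [#|T|]
    gives the same value. The recursion is the triangular inversion of the moment-cumulant relation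
    [sum_cumul]. *)
Fixpoint cumul_rec m T : R :=
  if m is m'.+1
  then tgt T - \sum_(S : {set E} | S \proper T) cumul_rec m' S * mom (T :\: S)
  else 0.

(* With [mom T] = E[X^T] and [tgt T] = E[x X^T], this is the joint cumulant of
   x and the X_e, e in T. *)
Definition cumul T := cumul_rec #|T|.+1 T.

Hypothesis mom0 : mom set0 = 1.

Lemma cumulE T :
  cumul T = tgt T - \sum_(S : {set E} | S \proper T) cumul S * mom (T :\: S).
Proof.
suff rec_eq m m' S : (#|S| < m)%N -> (#|S| < m')%N ->
    cumul_rec m S = cumul_rec m' S.
  rewrite /cumul /=; congr (_ - _); apply: eq_bigr => S ST.
  by rewrite (rec_eq #|T| #|S|.+1) // proper_card.
elim: m m' S => [|m IH] [|m'] S //; rewrite !ltnS => Sm Sm' /=.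
congr (_ - _); apply: eq_bigr => U /proper_card US; congr (_ * _).
by apply: IH; apply: leq_trans US _.
Qed.

Lemma sum_cumul T : \sum_(S : {set E} | S \subset T) cumul S * mom (T :\: S) = tgt T.
Proof.
rewrite (bigD1 T) //= setDv mom0 mulr1 cumulE.
under [X in _ - _ + X]eq_bigl => S do rewrite andbC -properEneq.
by rewrite subrK.
Qed.

(** Joint cumulants vanish when the variables of [T2] are independent of the rest. By the third
    hypothesis only subsets of [T1] remain in the recursion; the common factor [mom T2] comes out,
    and [sum_cumul] at [T1] leaves exactly [tgt T1 * mom T2]. *)
Lemma cumul_eq0 (T1 T2 : {set E}) : [disjoint T1 & T2] -> T2 != set0 ->
    (forall S, S \proper T1 :|: T2 -> ~~ (S \subset T1) -> cumul S = 0) ->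
    tgt (T1 :|: T2) = tgt T1 * mom T2 ->
    (forall S, S \subset T1 -> mom ((T1 :\: S) :|: T2) = mom (T1 :\: S) * mom T2) ->
  cumul (T1 :|: T2) = 0.
Proof.
move=> T12 T2N0 cumul0 tgtM momM.
rewrite cumulE (bigID (fun S : {set E} => S \subset T1)) /=.
rewrite [X in _ - (_ + X)]big1 ?addr0 => [|S /andP[ST NST1]]; last first.
  by rewrite cumul0 ?mul0r.
rewrite tgtM -(sum_cumul T1) mulr_suml.
apply/eqP; rewrite subr_eq0; apply/eqP; apply: eq_big => S.
  case: (boolP (S \subset T1)) => ST1; rewrite ?andbF ?andbT //.
  symmetry; apply: (sub_proper_trans ST1); rewrite properE subsetUl /=.
  apply: contra T2N0; rewrite subUset subxx /= => T21.
  by rewrite -subset0 -(setIidPr T21) (disjoint_setI0 T12).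
move=> ST1; rewrite -mulrA -momM //; congr (_ * mom _).
rewrite setDUl; congr (_ :|: _); symmetry; apply/setDidPl.
by apply: disjointWr ST1 _; rewrite disjoint_sym.
Qed.

(** With t = |T|, expand (t + 1)^t as the sum of t^|S| over all subsets S of T. A proper S has |S| +
    1 <= t, and the term S = T, at least 1, pays for the leading 1. *)
Lemma sum_proper_le T : T != set0 ->
  1 + \sum_(S : {set E} | S \proper T) (#|S|.+1)%:R ^+ #|S| <= (#|T|.+1)%:R ^+ #|T| :> R.
Proof.
move=> TN0; have T_gt0 : (0 < #|T|)%N by rewrite card_gt0.
have <- : \sum_(S : {set E} | S \subset T) #|T|%:R ^+ #|S| = #|T|.+1%:R ^+ #|T| :> R.
  rewrite -natr1 -prodr_const prodrD_subsets; apply: eq_bigr => S _.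
  by rewrite prodr_const [X in _ * X]big1 ?mulr1.
rewrite [leRHS](bigD1 T) //= lerD //; first by rewrite exprn_ege1 // ler1n.
under [leRHS]eq_bigl => S do rewrite andbC -properEneq.
apply: ler_sum => S /proper_card ST.
by rewrite lerXn2r ?nnegrE ?ler0n // ler_nat.
Qed.

(** Since [b] dominates the targets and absorbs the moments along inclusions, strong induction on
    the recursion leaves only the numerical sum of [sum_proper_le]. *)
Lemma cumul_le (P : pred {set E}) (b : {set E} -> R) :
    (forall S, ~~ P S -> cumul S = 0) ->
    (forall T, P T -> `|tgt T| <= b T) ->
    (forall S T, P S -> P T -> S \subset T -> b S * `|mom (T :\: S)| <= b T) ->
  forall T, P T -> `|cumul T| <= (#|T|.+1)%:R ^+ #|T| * b T.
Proof.
move=> cumul0 tgtb bmom T; have [m] := ubnP #|T|.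
elim: m T => // m IH T; rewrite ltnS => Tm PT.
have bT0 : 0 <= b T by apply: le_trans (tgtb T PT); rewrite normr_ge0.
have [T0|TN0] := eqVneq T set0.
  subst T; rewrite cumulE big1 => [|S]; last first.
    by rewrite properE => /andP[S0]; rewrite sub0set.
  by rewrite cards0 expr0 mul1r subr0 tgtb.
rewrite cumulE; apply: le_trans (ler_normB _ _) _.
apply: (@le_trans _ _ (b T + \sum_(S : {set E} | S \proper T) (#|S|.+1)%:R ^+ #|S| * b T)).
  rewrite lerD ?tgtb //; apply: le_trans (ler_norm_sum _ _ _) _.
  apply: ler_sum => S ST.
  have [PS|NPS] := boolP (P S); last first.
    by rewrite cumul0 // mul0r normr0 mulr_ge0 // exprn_ge0.
  rewrite normrM; apply: (@le_trans _ _ ((#|S|.+1)%:R ^+ #|S| * b S * `|mom (T :\: S)|)).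
    rewrite ler_wpM2r // IH //; exact: leq_trans (proper_card ST) Tm.
  by rewrite -mulrA ler_wpM2l ?exprn_ge0 // bmom // proper_sub.
by rewrite -mulr_suml -{1}[b T]mul1r -mulrDl ler_wpM2r // sum_proper_le.
Qed.

End Cumulants.

(** * Edge sets connected to a given edge *)

Section GrownEdgeSets.
Variables (I : finType) (e0 : I * I).
Implicit Types (e : I * I) (S T : {set I * I}) (V W : {set I}).

Definition ends e : {set I} := [set e.1; e.2].
Definition verts S : {set I} := ends e0 :|: \bigcup_(e in S) ends e.
Definition touch V e := (e.1 \in V) || (e.2 \in V).

Fixpoint grown_rec s S : bool :=
  if s is s'.+1
  then [exists e in S, grown_rec s' (S :\ e) && touch (verts (S :\ e)) e]
  else S == set0.

(* S can be built one edge at a time, each new edge touching e0 or a former edge;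
   equivalently, e0 and the edges in S form a connected graph. *)
Definition grown S := grown_rec #|S| S.

Lemma verts0 : verts set0 = ends e0.
Proof. by rewrite /verts big_set0 setU0. Qed.

Lemma vertsU1 e S : verts (e |: S) = ends e :|: verts S.
Proof.
by rewrite /verts bigcup_setU big_set1 setUCA.
Qed.

Lemma vertsS S T : S \subset T -> verts S \subset verts T.
Proof.
move=> ST; apply: setUS; apply/bigcupsP => e eS.
exact: bigcup_sup (subsetP ST e eS).
Qed.

Lemma ends_sub_verts e S : e \in S -> ends e \subset verts S.
Proof. by move=> eS; rewrite subsetU // orbC bigcup_sup. Qed.

Lemma grown0 : grown set0.
Proof. by rewrite /grown cards0 /=. Qed.

Lemma grownU1 e S : e \notin S -> grown S -> touch (verts S) e -> grown (e |: S).
Proof.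
move=> eS gS teS; rewrite /grown cardsU1 eS /=.
by apply/existsP; exists e; rewrite setU11 setU1K // teS andbT.
Qed.

Lemma grown_ind (P : {set I * I} -> Prop) : P set0 ->
    (forall e S, e \notin S -> grown S -> touch (verts S) e -> P S -> P (e |: S)) ->
  forall S, grown S -> P S.
Proof.
move=> P0 PU S; rewrite /grown; move cS : #|S| => s.
elim: s => [|s IH] in S cS *; first by move=> /eqP ->.
move=> /= /existsP[e /and3P[eS gS teS]].
have cSe : #|S :\ e| = s by move: cS; rewrite (cardsD1 e) eS => -[].
rewrite -(setD1K eS); apply: PU => //; first by rewrite setD11.
  by rewrite /grown cSe.
exact: IH.
Qed.

Lemma card_verts S : grown S -> (#|verts S| <= #|S|.+2)%N.
Proof.
elim/grown_ind: S / => [|e S eS gS teS IH].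
  by rewrite verts0 cards0 cards2; case: eqP.
rewrite vertsU1 cardsU1 eS /=; case/orP: teS => teS.
  apply: (@leq_trans #|e.2 |: verts S|); last by rewrite cardsU1 -!addnS leq_add ?leq_b1.
  by rewrite subset_leq_card // subUset subsetUr andbT subUset !sub1set setU11 in_setU1 teS orbT.
apply: (@leq_trans #|e.1 |: verts S|); last by rewrite cardsU1 -!addnS leq_add ?leq_b1.
by rewrite subset_leq_card // subUset subsetUr andbT subUset !sub1set setU11 in_setU1 teS orbT.
Qed.

(** [T1] is the connected component of [e0] in [T], taken as a grown subset of maximal size: an edge
    of [T] touching it could otherwise be added. *)
Lemma grown_core T : exists T1 T2, [/\ T = T1 :|: T2, [disjoint T1 & T2],
  grown T1, (forall e, e \in T2 -> ~~ touch (verts T1) e) &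
  forall S, grown S -> S \subset T -> S \subset T1].
Proof.
have g0 : (set0 \subset T) && grown set0 by rewrite sub0set grown0.
case: (@arg_maxnP _ set0 (fun S => (S \subset T) && grown S) (fun S => #|S|) g0).
move=> T1 /andP[T1T gT1] maxT1; exists T1, (T :\: T1).
have away e : e \in T :\: T1 -> ~~ touch (verts T1) e.
  rewrite inE => /andP[eT1 eT]; apply/negP => te.
  have := maxT1 (e |: T1); rewrite subUset sub1set eT T1T grownU1 //.
  by move/(_ isT); rewrite /geq /= cardsU1 eT1 add1n ltnn.
split => //.
- by rewrite -{1}(setID T T1) (setIidPr T1T).
- by rewrite -setI_eq0; apply/eqP/setP => e; rewrite !inE; case: (e \in T1).
apply: grown_ind => [_|e S eS gS teS IH]; first exact: sub0set.
rewrite subUset sub1set => /andP[eT ST]; rewrite subUset (IH ST) andbT sub1set.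
apply/negPn/negP => eT1; have := away e; rewrite inE eT1 eT => /(_ isT).
by case/orP: teS => /(subsetP (vertsS (IH ST))) h; rewrite /touch h ?orbT.
Qed.

Lemma touchP S e : touch (verts S) e ->
  if (e.1 \in verts S) && (e.2 \in verts S) then verts (e |: S) = verts S
  else exists y u, [/\ y \in verts S, u \notin verts S,
    verts (e |: S) = u |: verts S & e = (y, u) \/ e = (u, y)].
Proof.
case: e => x y; rewrite /touch vertsU1 /=.
case: (boolP (x \in verts S)) => xS; case: (boolP (y \in verts S)) => yS //= _.
- by apply/setUidPr; rewrite subUset !sub1set xS.
- exists x, y; split=> //; last by left.
  by rewrite [ends _]setUC -setUA; congr (_ :|: _); apply/setUidPr; rewrite sub1set.
- exists y, x; split=> //; last by right.
  by rewrite -setUA; congr (_ :|: _); apply/setUidPr; rewrite sub1set.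
Qed.

(** The ends of [e0] are given, so only these vertices are free: each can be chosen in |I| ways and
    costs a power of 1/k. *)
Definition outer T := verts T :\: ends e0.

Lemma card_outerU1 S e : touch (verts S) e ->
  #|outer (e |: S)| = (#|outer S| + ~~ ((e.1 \in verts S) && (e.2 \in verts S)))%N.
Proof.
move=> /touchP; case: ifP => _; first by rewrite /outer addn0 => ->.
move=> [y [u [yS uS eS _]]]; rewrite /outer eS setDUl.
have /setDidPl -> : [disjoint [set u] & ends e0].
  rewrite disjoints1; apply: contra uS; apply/subsetP; exact: subsetUl.
by rewrite cardsU1 in_setD (negbTE uS) andbF addnC.
Qed.

Lemma grown_rec_card s S : grown_rec s S -> #|S| = s.
Proof.
elim: s S => [|s IH] S /=; first by move=> /eqP ->; rewrite cards0.
by move=> /existsP[e /and3P[eS /IH cS _]]; rewrite (cardsD1 e) eS cS.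
Qed.

Lemma grown_recE s S : grown_rec s S = grown S && (#|S| == s).
Proof.
apply/idP/andP => [gS|[gS /eqP <-] //].
by rewrite /grown (grown_rec_card gS) eqxx.
Qed.

Variable R : realFieldType.

(** Edges are ordered pairs, so the end lying in [V] may be either coordinate; hence the factor 2 on
    the second term. *)
Lemma sum_touch_le V (a b : R) : 0 <= a -> 0 <= b ->
  \sum_(e | touch V e) (if (e.1 \in V) && (e.2 \in V) then a else b) <=
  #|V|%:R ^+ 2 * a + (#|V| * #|I|)%:R * b *+ 2.
Proof.
move=> a0 b0.
have sumV : \sum_i (i \in V)%:R = #|V|%:R :> R.
  by rewrite -sum1_card natr_sum [RHS]big_mkcond; apply: eq_bigr => i _; case: (i \in V).
have sumI : \sum_(i : I) 1 = #|I|%:R :> R by rewrite sumr_const.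
apply: (@le_trans _ _ (\sum_(e : I * I) ((e.1 \in V)%:R * (e.2 \in V)%:R * a +
    ((e.1 \in V)%:R * 1 * b + 1 * (e.2 \in V)%:R * b)))).
  rewrite big_mkcond; apply: ler_sum => -[i j] _ /=; rewrite /touch /=.
  by case: (i \in V); case: (j \in V); rewrite /= ?mul1r ?mul0r ?mulr1; lra.
have split_sum (f g : I -> R) c :
    \sum_(e : I * I) f e.1 * g e.2 * c = (\sum_i f i) * (\sum_i g i) * c.
  by rewrite -mulr_suml big_distrlr pair_big.
rewrite !big_split /=.
rewrite (split_sum (fun i => (i \in V)%:R) (fun i => (i \in V)%:R)).
rewrite (split_sum (fun i => (i \in V)%:R) (fun=> 1)).
rewrite (split_sum (fun=> 1) (fun i => (i \in V)%:R)) sumV sumI.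
by rewrite natrM; lra.
Qed.

Lemma sum_grownS_le (a b : R) s : 0 <= a -> 0 <= b ->
  \sum_(S | grown_rec s.+1 S) a ^+ #|S| * b ^+ #|outer S| <=
  (\sum_(S | grown_rec s S) a ^+ #|S| * b ^+ #|outer S|) *
     (s.+2%:R ^+ 2 * a + (s.+2 * #|I|)%:R * (a * b) *+ 2).
Proof.
move=> a0 b0; pose h S := a ^+ #|S| * b ^+ #|outer S|.
rewrite -[X in X <= _]/(\sum_(S | _ S) h S) -[X in _ <= X * _]/(\sum_(S | _ S) h S).
have h0 S : 0 <= h S by rewrite mulr_ge0 ?exprn_ge0.
(* Sum over all admissible last edges of [S] instead of choosing one. The weights are nonnegative,
   so overcounting is harmless, and removing the last edge reduces to grown sets of size [s]. *)
apply: (@le_trans _ _ (\sum_(S : {set I * I})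
    \sum_(e | (e \in S) && (grown_rec s (S :\ e) && touch (verts (S :\ e)) e)) h S)).
  rewrite big_mkcond; apply: ler_sum => S _; case: ifP => [|_]; last exact: sumr_ge0.
  by move=> /existsP[e eS]; rewrite (bigD1 e) //= lerDl sumr_ge0.
rewrite (exchange_big_dep xpredT) //=.
have reidx e : \sum_(S : {set I * I} |
      (e \in S) && (grown_rec s (S :\ e) && touch (verts (S :\ e)) e)) h S =
    \sum_(S : {set I * I} | (e \notin S) && (grown_rec s S && touch (verts S) e)) h (e |: S).
  rewrite (reindex_onto (fun S => e |: S) (fun S => S :\ e)) /=; last first.
    by move=> S /andP[eS _]; rewrite setD1K.
  apply: eq_bigl => S; rewrite setU11 /=.
  have [eS|eS] := boolP (e \in S); last by rewrite setU1K // eqxx andbT.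
  by rewrite andbC; case: eqP => // E; move: (setD11 e (e |: S)); rewrite E eS.
under eq_bigr do rewrite reidx.
rewrite (exchange_big_dep (grown_rec s)) /=; last by move=> e S _ /and3P[].
rewrite mulr_suml; apply: ler_sum => S gS.
apply: (@le_trans _ _ (\sum_(e | touch (verts S) e)
   h S * (if (e.1 \in verts S) && (e.2 \in verts S) then a else a * b))).
  rewrite big_mkcond [leRHS]big_mkcond; apply: ler_sum => e _.
  case: ifP => [/and3P[eS _ te]|_]; last first.
    by case: ifP => // _; rewrite mulr_ge0 //; case: ifP; rewrite ?mulr_ge0.
  rewrite te /h cardsU1 eS card_outerU1 //.
  by case: ifP => _; rewrite ?addn0 ?addn1 add1n !exprS; lra.
rewrite -mulr_sumr ler_wpM2l //.
apply: le_trans (sum_touch_le _ a0 (mulr_ge0 a0 b0)) _.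
have cV : (#|verts S| <= s.+2)%N.
  by move: gS; rewrite grown_recE => /andP[gS /eqP <-]; exact: card_verts.
rewrite lerD //.
  by rewrite ler_wpM2r // lerXn2r ?nnegrE ?ler0n // ler_nat.
by rewrite lerMn2r /= ler_wpM2r ?mulr_ge0 // ler_nat leq_mul2r cV orbT.
Qed.

End GrownEdgeSets.

(** * Cumulants of the community prior *)

Section CommunityCumulants.
Variables (R : realFieldType) (I K : finType).
Hypothesis K_gt0 : (0 < #|K|)%N.
Variables (lam : R) (e0 : I * I).
Hypotheses (lam_ge0 : 0 <= lam) (e0_neq : e0.1 != e0.2).
Implicit Types (z : {ffun I -> K}) (e : I * I) (S T : {set I * I}).

Definition mono z e : R := (z e.1 == z e.2)%:R.
Definition signal z e : R := lam * mono z e.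
Definition mom T := unif (fun z : {ffun I -> K} => \prod_(e in T) signal z e).
Definition tgt T :=
  unif (fun z : {ffun I -> K} => signal z e0 * \prod_(e in T) signal z e).
Definition kappa := cumul mom tgt.

Lemma mono_ge0 z e : 0 <= mono z e. Proof. exact: ler0n. Qed.

Lemma mono_le1 z e : mono z e <= 1. Proof. by rewrite lern1 leq_b1. Qed.

Lemma signal_ge0 z e : 0 <= signal z e.
Proof. by rewrite mulr_ge0 ?mono_ge0. Qed.

Lemma mom0 : mom set0 = 1.
Proof.
rewrite /mom -[RHS](unif_cst I K_gt0 1).
by apply: eq_unif => z; rewrite big_set0.
Qed.

Lemma mom_ge0 T : 0 <= mom T.
Proof. by apply: unif_ge0 => // z; apply: prodr_ge0 => e _; apply: signal_ge0. Qed.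

Lemma local_signal (V : {set I}) e : ends e \subset V ->
  local V (fun z => signal z e).
Proof.
rewrite subUset !sub1set => /andP[e1V e2V] z z' zz'.
by rewrite /signal /mono !zz'.
Qed.

Lemma local_prod (V : {set I}) T (F : {ffun I -> K} -> I * I -> R) :
  (forall e, e \in T -> local V (F^~ e)) ->
  local V (fun z => \prod_(e in T) F z e).
Proof.
by move=> FV z z' zz'; apply: eq_bigr => e eT; apply: FV eT _ _ zz'.
Qed.

(** Let [T1] be the component of [e0]. The edges of [T2] avoid its vertices, so their signals are
    independent of those of [e0] and [T1], and [cumul_eq0] applies. Smaller sets not inside [T1] are
    not grown, so the induction hypothesis kills their cumulants. *)
Lemma kappa_eq0 T : ~~ grown e0 T -> kappa T = 0.
Proof.
have [m] := ubnP #|T|; elim: m T => // m IH T; rewrite ltnS => Tm NgT.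
have [T1 [T2 [defT T12 gT1 away core]]] := grown_core e0 T.
have T2N0 : T2 != set0.
  by apply: contraNneq NgT => T20; rewrite defT T20 setU0.
have loc1 S : S \subset T1 ->
    local (verts e0 T1) (fun z => \prod_(e in S) signal z e).
  move=> ST1; apply: local_prod => e eS; apply: local_signal.
  by apply: ends_sub_verts; apply: (subsetP ST1).
have loc2 : local (~: verts e0 T1) (fun z => \prod_(e in T2) signal z e).
  apply: local_prod => e eT2; apply: local_signal.
  have := away e eT2; rewrite /touch negb_or => /andP[e1 e2].
  by rewrite subUset !sub1set !in_setC e1.
have loc0 : local (verts e0 T1) (fun z => signal z e0).
  by apply: local_signal; rewrite subsetUl.
have prodU S z : S \subset T1 -> \prod_(e in S :|: T2) signal z e =
    \prod_(e in S) signal z e * \prod_(e in T2) signal z e.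
  move=> ST1; rewrite (eq_bigl [predU S & T2]); last by move=> e; rewrite !inE.
  by rewrite bigU //=; apply: disjointWl ST1 T12.
rewrite defT; apply: cumul_eq0 => //.
- exact: mom0.
- move=> S ST NST1; apply: IH.
    by apply: leq_trans Tm; rewrite defT proper_card.
  by apply: contra NST1 => gS; apply: core => //; rewrite defT proper_sub.
- rewrite /tgt /mom -(unif_indep K_gt0 (V := verts e0 T1)) //; last first.
    exact: localM loc0 (loc1 _ (subxx _)).
  by apply: eq_unif => z; rewrite prodU // mulrA.
- move=> S ST1; rewrite /mom -(unif_indep K_gt0 (V := verts e0 T1)) //; last first.
    exact: loc1 (subsetDl _ _).
  by apply: eq_unif => z; rewrite prodU // subsetDl.
Qed.

(** Edges inside [W] are neutralised rather than removed, so that products still run over a whole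
    grown set and can be treated by induction on its growth. *)
Definition mono_out (W : {set I}) z e : R :=
  if (e.1 \in W) && (e.2 \in W) then 1 else mono z e.

Lemma mono_out_ge0 W z e : 0 <= mono_out W z e.
Proof. by rewrite /mono_out; case: ifP => // _; apply: mono_ge0. Qed.

Lemma mono_out_le1 W z e : mono_out W z e <= 1.
Proof. by rewrite /mono_out; case: ifP => // _; apply: mono_le1. Qed.

(** Follow the growth of [T]: an edge reaching a new vertex outside [W] gains 1/k by [unif_match],
    since that vertex occurs nowhere else so far; the factor of any other edge is bounded by 1. *)
Lemma unif_mono_out T (W : {set I}) (g : {ffun I -> K} -> R) :
    grown e0 T -> ends e0 \subset W -> (forall z, 0 <= g z) -> local W g ->
  unif (fun z => g z * \prod_(e in T) mono_out W z e) <=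
  unif g * #|K|%:R ^- #|verts e0 T :\: W|.
Proof.
move=> gT e0W g0 gW; elim/grown_ind: T / gT => [|e T eT gT teT IH].
  rewrite verts0 (_ : _ :\: _ = set0) ?cards0 ?expr0 ?invr1 ?mulr1; last first.
    by apply/eqP; rewrite setD_eq0.
  by apply: ler_unif => z; rewrite big_set0 mulr1.
have prod0 z : 0 <= \prod_(e in T) mono_out W z e.
  by apply: prodr_ge0 => e' _; apply: mono_out_ge0.
have drop : unif (fun z => g z * \prod_(f in e |: T) mono_out W z f) <=
    unif (fun z => g z * \prod_(e in T) mono_out W z e).
  apply: ler_unif => z; rewrite ler_wpM2l // big_setU1 //=.
  by rewrite ler_piMl // mono_out_le1.
move/touchP: (teT); case: ifP => [_ ->|_ [y [u [yT uT -> eyu]]]].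
  exact: le_trans drop IH.
have [uW|uW] := boolP (u \in W).
  rewrite setDUl (_ : [set u] :\: W = set0) ?set0U; first exact: le_trans drop IH.
  by apply/eqP; rewrite setD_eq0 sub1set.
have -> : #|(u |: verts e0 T) :\: W| = #|verts e0 T :\: W|.+1.
  rewrite setDUl (_ : [set u] :\: W = [set u]); last first.
    by apply/setDidPl; rewrite disjoints1.
  by rewrite cardsU1 in_setD (negbTE uT) andbF add1n.
have yu : y != u by apply: contraNneq uT => <-.
have -> : unif (fun z => g z * \prod_(f in e |: T) mono_out W z f) =
    unif (fun z => (g z * \prod_(e in T) mono_out W z e) * (z y == z u)%:R).
  apply: eq_unif => z; rewrite big_setU1 //= mulrCA mulrC; congr (_ * _).
  rewrite /mono_out /mono; case: eyu => ->; rewrite /= (negbTE uW) ?andbF //.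
  by rewrite eq_sym.
rewrite unif_match //; first by rewrite exprSr invfM mulrA ler_wpM2r ?invr_ge0.
apply: localM.
  by apply: localS gW; rewrite subsetC sub1set in_setC.
apply: local_prod => e' e'T z z' zz'; rewrite /mono_out; case: ifP => // _.
have e'u i : i \in ends e' -> i \in ~: [set u].
  move=> ie'; rewrite !inE; apply: contraNneq uT => <-.
  by apply: (subsetP (ends_sub_verts e0 e'T)).
by rewrite /mono !zz' // e'u // !inE eqxx ?orbT.
Qed.

(** As [e0] has two distinct ends, [#|outer e0 T|.+1] is v - 1 for v vertices, the size of a
    spanning tree of [e0] and [T]. *)
Definition cumul_bound T : R :=
  lam ^+ #|T|.+1 * #|K|%:R ^- #|outer e0 T|.+1.

Lemma cumul_bound_ge0 T : 0 <= cumul_bound T.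
Proof. by rewrite mulr_ge0 ?invr_ge0 ?exprn_ge0. Qed.

(** Apply [unif_mono_out] with [W] the ends of [e0]; the agreement on [e0] itself supplies the extra
    factor 1/k. *)
Lemma tgt_le T : grown e0 T -> `|tgt T| <= cumul_bound T.
Proof.
move=> gT; rewrite ger0_norm; last first.
  apply: unif_ge0 => // z; rewrite mulr_ge0 ?signal_ge0 //.
  by apply: prodr_ge0 => e _; apply: signal_ge0.
have loc0 : local (ends e0) (fun z => mono z e0).
  by move=> z z' zz'; rewrite /mono !zz' // !inE eqxx ?orbT.
have := unif_mono_out gT (subxx _) (fun z => mono_ge0 z e0) loc0.
rewrite -/(outer e0 T) => /(ler_wpM2l (exprn_ge0 #|T|.+1 lam_ge0)).
have -> : unif (fun z => mono z e0) = #|K|%:R^-1.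
  rewrite -[RHS]mul1r -[X in X * _](unif_cst I K_gt0 1).
  by rewrite -(unif_match K_gt0 e0_neq) //; apply: eq_unif => z; rewrite mul1r.
rewrite -invfM -exprS -/(cumul_bound T); apply: le_trans.
rewrite -unifZ; apply: ler_unif => // z.
rewrite big_split /= prodr_const exprS /signal.
have : \prod_(e in T) mono z e <= \prod_(e in T) mono_out (ends e0) z e.
  apply: ler_prod => e _; rewrite mono_ge0 /= /mono_out.
  by case: ifP; rewrite ?mono_le1.
have := exprn_ge0 #|T| lam_ge0; have := mono_ge0 z e0.
set A := \prod_(_ in _) _; set B := \prod_(_ in _) _; set L := lam ^+ _.
move=> m0 L0 AB.
have -> : lam * mono z e0 * (L * A) = (lam * L * mono z e0) * A by ring.
have -> : lam * L * (mono z e0 * B) = (lam * L * mono z e0) * B by ring.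
by rewrite ler_wpM2l ?mulr_ge0.
Qed.

(** Apply [unif_mono_out] with [W] the vertices of [S]: edges of [S] contribute 1 there, so the
    product over [T :\: S] is dominated by one over the grown set [T]. The vertex exponents then add
    up exactly. *)
Lemma cumul_bound_mom S T : grown e0 T -> S \subset T ->
  cumul_bound S * `|mom (T :\: S)| <= cumul_bound T.
Proof.
move=> gT ST; rewrite ger0_norm ?mom_ge0 //.
have e0W : ends e0 \subset verts e0 S by apply: subsetUl.
have := unif_mono_out gT e0W (fun=> ler01) (@local_cst _ _ _ _ 1).
rewrite unif_cst // mul1r => momT.
have le_mom : mom (T :\: S) <=
    lam ^+ #|T :\: S| * #|K|%:R ^- #|verts e0 T :\: verts e0 S|.
  apply: le_trans (ler_wpM2l (exprn_ge0 _ lam_ge0) momT).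
  rewrite -unifZ; apply: ler_unif => // z.
  rewrite big_split /= prodr_const ler_wpM2l ?exprn_ge0 // mul1r.
  rewrite big_mkcond [leRHS]big_mkcond; apply: ler_prod => e _.
  rewrite inE /mono_out; case: (boolP (e \in S)) => eS /=.
    rewrite ler01 /=; have := ends_sub_verts e0 eS.
    by rewrite subUset !sub1set => /andP[-> ->]; rewrite /= if_same.
  case: (e \in T); last by rewrite ler01 lexx.
  by rewrite mono_ge0 /=; case: ifP => _; rewrite ?mono_le1.
apply: le_trans (ler_wpM2l (cumul_bound_ge0 S) le_mom) _.
rewrite /cumul_bound mulrACA -exprD -invfM -exprD addSn.
have -> : (#|S| + #|T :\: S| = #|T|)%N.
  by rewrite -(cardsID S T) (setIidPr ST).
rewrite addSn.
suff -> : (#|outer e0 S| + #|verts e0 T :\: verts e0 S| = #|outer e0 T|)%N by [].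
rewrite -(cardsID (verts e0 S) (outer e0 T)); congr (_ + _)%N.
  apply: eq_card => i; rewrite in_setI !in_setD andbC.
  case: (boolP (i \in verts e0 S)) => iS; rewrite ?andbF //=.
  by rewrite (subsetP (vertsS e0 ST)) // !andbT.
apply: eq_card => i; rewrite !in_setD; case: (boolP (i \in ends e0)) => //= ie.
by rewrite (subsetP e0W i ie).
Qed.

Lemma kappa_le T : grown e0 T ->
  `|kappa T| <= (#|T|.+1)%:R ^+ #|T| * cumul_bound T.
Proof.
apply: cumul_le; first exact: kappa_eq0.
  exact: tgt_le.
by move=> S U _ gU SU; apply: cumul_bound_mom.
Qed.

(** Here [eps] bounds both growth costs, lam^2 for an edge between reached vertices and n lam^2 /
    k^2 for one with a new vertex, while [gam] stands for a bound on the inverse variance of an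
    edge. *)
Lemma kappa_energy (D : nat) (gam eps : R) : (0 < D)%N -> 0 <= gam -> 0 <= eps ->
    lam ^+ 2 <= eps -> #|I|%:R * (lam ^+ 2 * #|K|%:R ^- 2) <= eps ->
    32 * gam * eps * D%:R ^+ 4 <= 1 / 3 ->
  \sum_(S : {set I * I} | (#|S| <= D)%N) kappa S ^+ 2 * gam ^+ #|S| <=
    3 / 2 * (lam / #|K|%:R) ^+ 2.
Proof.
move=> D0 gam0 eps0 lam_eps lamI_eps small.
set a := lam ^+ 2 in lam_eps lamI_eps *; set b := #|K|%:R ^- 2 in lamI_eps *.
have a0 : 0 <= a by apply: exprn_ge0.
have b0 : 0 <= b by rewrite invr_ge0 exprn_ge0.
pose h S := a ^+ #|S| * b ^+ #|outer e0 S|.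
have h0 S : 0 <= h S by rewrite mulr_ge0 ?exprn_ge0.
have D1 : 1 <= D%:R :> R by rewrite ler1n.
(* At most D + 1 vertices are present before each growth step, so it costs at most ((D + 1)^2 + 2 (D
   + 1)) eps, and D^2 + 4 D + 3 <= 8 D^2. *)
have level s : (s <= D)%N ->
    \sum_(S | grown_rec e0 s S) h S <= (8 * D%:R ^+ 2 * eps) ^+ s.
  elim: s => [|s IH] sD.
    by rewrite (big_pred1 set0) // /h /outer verts0 setDv !cards0 !expr0 mulr1.
  apply: le_trans (sum_grownS_le e0 s a0 b0) _; rewrite [leRHS]exprSr.
  apply: ler_pM.
  - by apply: sumr_ge0 => S _; apply: h0.
  - by rewrite addr_ge0 ?mulrn_wge0 ?mulr_ge0.
  - exact: IH (ltnW sD).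
  have s2D : s.+2%:R <= D%:R + 1 :> R by rewrite natr1 ler_nat ltnS.
  have s0 : 0 <= s.+2%:R :> R by [].
  rewrite natrM -mulrA -mulrnAr.
  have v0 : 0 <= #|I|%:R * (a * b) by rewrite !mulr_ge0.
  move: s.+2%:R s2D s0 (#|I|%:R * _) lamI_eps v0 => u uD u0 v v_eps v0.
  have ? : u ^+ 2 * a <= (D%:R + 1) ^+ 2 * eps.
    apply: ler_pM => //; first exact: sqr_ge0.
    by rewrite lerXn2r ?nnegrE ?addr_ge0.
  have ? : u * (v *+ 2) <= (D%:R + 1) * (eps *+ 2).
    by apply: ler_pM => //; rewrite ?mulrn_wge0 // lerMn2r.
  have ? : D%:R * eps <= D%:R ^+ 2 * eps :> R.
    by rewrite ler_wpM2r // expr2 ler_peMl // ler0n.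
  have ? : eps <= D%:R * eps by rewrite ler_peMl.
  by lra.
have term S : (#|S| <= D)%N -> kappa S ^+ 2 * gam ^+ #|S| <=
    if grown e0 S then (lam / #|K|%:R) ^+ 2 * ((4 * D%:R ^+ 2 * gam) ^+ #|S| * h S)
    else 0.
  move=> SD; case: ifPn => [gS|NgS]; last by rewrite kappa_eq0 // expr0n mul0r.
  have := kappa_le gS; rewrite -(ler_pXn2r (ltn0Sn 1)) ?nnegrE ?normr_ge0 //; last first.
    by rewrite mulr_ge0 ?cumul_bound_ge0 ?exprn_ge0.
  rewrite real_normK ?num_real // => kS.
  apply: le_trans (ler_wpM2r (exprn_ge0 _ gam0) kS) _.
  have N2 : (#|S|.+1)%:R ^+ 2 <= 4 * D%:R ^+ 2 :> R.
    have : (#|S|.+1)%:R <= 2 * D%:R :> R by rewrite -natrM ler_nat mul2n -addnn -addn1 leq_add.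
    by have : 0 <= (#|S|.+1)%:R :> R := ler0n _ _; nra.
  have -> : (#|S|.+1%:R ^+ #|S| * cumul_bound S) ^+ 2 * gam ^+ #|S| =
      (lam / #|K|%:R) ^+ 2 * (((#|S|.+1)%:R ^+ 2 * gam) ^+ #|S| * h S).
    have k0 : #|K|%:R != 0 :> R by rewrite pnatr_eq0 -lt0n.
    rewrite /cumul_bound /h /a /b (exprS lam) (exprS _ #|outer e0 S|).
    rewrite [X in _ = _ * (X * _)]exprMn exprVn ![(_ ^+ 2) ^+ _]exprAC.
    by field; rewrite k0 expf_neq0.
  rewrite ler_wpM2l ?sqr_ge0 // ler_wpM2r //.
  by rewrite lerXn2r ?nnegrE ?mulr_ge0 ?sqr_ge0 // ler_wpM2r.
apply: le_trans (ler_sum _ term) _.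
rewrite -big_mkcondr /= -mulr_sumr mulrC ler_wpM2r ?sqr_ge0 //.
pose q := 4 * D%:R ^+ 2 * gam * (8 * D%:R ^+ 2 * eps).
have q0 : 0 <= q by rewrite !mulr_ge0.
have q13 : q <= 1 / 3.
  by rewrite (_ : q = 32 * gam * eps * D%:R ^+ 4) // /q; ring.
(* The value 3/2 is 1 / (1 - 1/3), a fixed point of the recursion below at ratio 1/3. *)
have geom m : \sum_(s < m) q ^+ s <= 3 / 2.
  elim: m => [|m IH]; first by rewrite big_ord0; lra.
  rewrite big_ord_recl expr0; under eq_bigr do rewrite exprS.
  by rewrite -mulr_sumr; nra.
apply: le_trans (geom D.+1).
rewrite (partition_big (fun S : {set I * I} => inord #|S| : 'I_D.+1) xpredT) //=.
apply: ler_sum => s _; rewrite exprMn.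
apply: le_trans (ler_wpM2l _ (level s (ltn_ord s))); last by rewrite exprn_ge0 // !mulr_ge0.
rewrite mulr_sumr big_mkcond [leRHS]big_mkcond; apply: ler_sum => S _ /=.
rewrite grown_recE; case: ifP => [/andP[/andP[SD gS] /eqP Ss]|_].
  by rewrite -Ss inordK ?ltnS // gS eqxx.
by case: ifP => // _; rewrite mulr_ge0 ?exprn_ge0 // !mulr_ge0.
Qed.

End CommunityCumulants.

(** * Expectations over the graph *)

Definition upper (n : nat) : {set 'I_n * 'I_n} := [set e : 'I_n * 'I_n | (e.1 < e.2)%N].

Section Observation.
Variables (R : realType) (n : nat).
Implicit Types (M : 'M[R]_n) (A : 'M[bool]_n) (e : 'I_n * 'I_n)
  (S T : {set 'I_n * 'I_n}) (f g : 'M[bool]_n -> R).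

Lemma eq_expect M f g : (forall A, is_adjacency A -> f A = g A) ->
  expect M f = expect M g.
Proof.
move=> fg; apply: eq_bigr => A _; rewrite /adjacency_pmf.
by case: ifP => [/fg ->|]; rewrite ?mul0r.
Qed.

Lemma expectZ M (a : R) f : expect M (fun A => a * f A) = a * expect M f.
Proof. by rewrite /expect mulr_sumr; apply: eq_bigr => A _; rewrite mulrCA. Qed.

Lemma expect_sum M (J : Type) (r : seq J) (P : pred J) (F : J -> 'M[bool]_n -> R) :
  expect M (fun A => \sum_(j <- r | P j) F j A) =
  \sum_(j <- r | P j) expect M (F j).
Proof.
by rewrite /expect exchange_big; apply: eq_bigr => A _; rewrite mulr_sumr.
Qed.

Lemma expectD M f g : expect M (fun A => f A + g A) = expect M f + expect M g.
Proof. by rewrite /expect -big_split; apply: eq_bigr => A _; rewrite mulrDr. Qed.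

Lemma adjacency_pmf_ge0 M A : (forall i j, 0 <= M i j <= 1) -> 0 <= adjacency_pmf M A.
Proof.
move=> M01; rewrite /adjacency_pmf; case: ifP => // _.
by apply: prodr_ge0 => i _; apply: prodr_ge0 => j _; apply: bernoulli_pmf_ge0.
Qed.

Lemma ler_expect M f g : (forall i j, 0 <= M i j <= 1) -> (forall A, f A <= g A) ->
  expect M f <= expect M g.
Proof.
by move=> M01 fg; apply: ler_sum => A _; rewrite ler_wpM2l ?adjacency_pmf_ge0.
Qed.

Definition graph_of S : 'M[bool]_n :=
  \matrix_(i, j) (((i, j) \in S) || ((j, i) \in S)).

Lemma graph_ofE S e : S \subset upper n -> e \in upper n ->
  graph_of S e.1 e.2 = (e \in S).
Proof.
move=> /subsetP SU; rewrite mxE -surjective_pairing => eU.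
case: (boolP (_ \in S)) => //= _; apply/negP => /SU; move: eU; rewrite !inE /=; lia.
Qed.

Lemma graph_of_adjacency S : S \subset upper n -> is_adjacency (graph_of S).
Proof.
move=> /subsetP SU; apply/andP; split.
  by apply/eqP/matrixP => i j; rewrite !mxE orbC.
by apply/forallP => i; rewrite mxE orbb; apply/negP => /SU; rewrite inE ltnn.
Qed.

(** Adjacency matrices correspond to subsets of [upper n], so the sum over graphs is the subset
    expansion of the product of one-edge expectations. *)
Lemma expect_prod M (phi : 'I_n * 'I_n -> bool -> R) :
  expect M (fun A => \prod_(e in upper n) phi e (A e.1 e.2)) =
  \prod_(e in upper n) (M e.1 e.2 * phi e true + (1 - M e.1 e.2) * phi e false).
Proof.
pose F e b := bernoulli_pmf (M e.1 e.2) b * phi e b.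
have -> : expect M (fun A => \prod_(e in upper n) phi e (A e.1 e.2)) =
    \sum_(A | is_adjacency A) \prod_(e in upper n) F e (A e.1 e.2).
  rewrite /expect [RHS]big_mkcond; apply: eq_bigr => A _; rewrite /adjacency_pmf.
  case: ifP => _; last by rewrite mul0r.
  rewrite pair_big_dep /= -[X in _ * X = _]mul1r.
  rewrite (eq_bigl (fun e => e \in upper n)); last by move=> e; rewrite inE.
  by rewrite mul1r -big_split.
pose edges_of A : {set 'I_n * 'I_n} := [set e in upper n | A e.1 e.2].
rewrite (reindex_onto graph_of edges_of) /=; last first.
  move=> A /andP[/eqP AT /forallP A0]; apply/matrixP => i j; rewrite !mxE !inE /=.
  case: (ltngtP i j) => //= ij; rewrite ?orbF //.
    by rewrite -{1}AT mxE.
  by rewrite (ord_inj ij) (negbTE (A0 j)).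
rewrite prodrD_subsets; apply: eq_big => S.
  apply/andP/idP => [[_ /eqP <-]|SU].
    by apply/subsetP => e; rewrite inE => /andP[].
  split; first exact: graph_of_adjacency.
  apply/eqP/setP => e; rewrite inE.
  case: (boolP (e \in upper n)) => eU /=; first exact: graph_ofE.
  by symmetry; apply: contraNF eU; apply: (subsetP SU).
move=> /andP[_ /eqP hS].
have SU : S \subset upper n by rewrite -hS; apply/subsetP => e; rewrite inE => /andP[].
rewrite (bigID (mem S)) /=; congr (_ * _).
  rewrite (eq_bigl (fun e => e \in S)) => [|e].
    by apply: eq_bigr => e eS; rewrite graph_ofE ?eS // (subsetP SU).
  by case: (boolP (e \in S)) => eS; rewrite ?andbF ?andbT // (subsetP SU).
apply: eq_big => e; first by rewrite !inE andbC.
by move=> /andP[eU /negbTE eS]; rewrite graph_ofE // eS.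
Qed.

Lemma expect_cst M (a : R) : expect M (fun=> a) = a.
Proof.
rewrite -[a]mulr1 expectZ; congr (_ * _).
have := expect_prod M (fun _ _ => 1).
rewrite [X in _ = X]big1 => [E|e _]; last by rewrite !mulr1 addrC subrK.
by rewrite -[RHS]E; apply: eq_expect => A _; rewrite big1.
Qed.

(** The derivative of the Bernoulli log-likelihood in its parameter: it has mean 0, variance 1 / (M
    (1 - M)), and covariance 1 with the edge. *)
Definition score M e (b : bool) : R := (b%:R - M e.1 e.2) / (M e.1 e.2 * (1 - M e.1 e.2)).

Lemma expect_prod2 M S T (F G : 'I_n * 'I_n -> bool -> R) :
    S \subset upper n -> T \subset upper n ->
  let phi e b := (if e \in S then F e b else 1) * (if e \in T then G e b else 1) in
  expect M (fun A => (\prod_(e in S) F e (A e.1 e.2)) * \prod_(e in T) G e (A e.1 e.2)) =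
  \prod_(e in upper n) (M e.1 e.2 * phi e true + (1 - M e.1 e.2) * phi e false).
Proof.
move=> SU TU phi; rewrite -expect_prod; apply: eq_expect => A _.
rewrite big_split /=; congr (_ * _).
  rewrite [LHS]big_mkcond [RHS]big_mkcond; apply: eq_bigr => e _.
  by case: ifP => eS; rewrite ?if_same // (subsetP SU).
rewrite [LHS]big_mkcond [RHS]big_mkcond; apply: eq_bigr => e _.
by case: ifP => eS; rewrite ?if_same // (subsetP TU).
Qed.

(** Edge by edge, the factor is 0 on [S :\: T], 1 on the intersection whatever [p] is, and M - p on
    [T :\: S]. *)
Lemma expect_score_centered M S T (p : R) : S \subset upper n -> T \subset upper n ->
    (forall e, e \in upper n -> 0 < M e.1 e.2 < 1) ->
  expect M (fun A => (\prod_(e in S) score M e (A e.1 e.2)) *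
                     \prod_(e in T) ((A e.1 e.2)%:R - p)) =
  if S \subset T then \prod_(e in T :\: S) (M e.1 e.2 - p) else 0.
Proof.
move=> SU TU M01; rewrite (@expect_prod2 M S T (score M) (fun _ b => b%:R - p)) //=.
rewrite (eq_bigr (fun e => if e \in S then (e \in T)%:R else
    if e \in T then M e.1 e.2 - p else 1)) => [|e /M01/andP[M0 M1]]; last first.
  have MN0 : M e.1 e.2 != 0 by rewrite gt_eqF.
  have MN1 : 1 - M e.1 e.2 != 0 by rewrite gt_eqF // subr_gt0.
  by rewrite /score; case: (e \in S); case: (e \in T); rewrite /=; field; rewrite ?MN0 ?MN1.
case: ifPn => [ST|/subsetPn[e eS eT]]; last first.
  by rewrite (bigD1 e) ?(subsetP SU) //= eS (negbTE eT) mul0r.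
rewrite [LHS]big_mkcond [RHS]big_mkcond; apply: eq_bigr => e _; rewrite in_setD.
case: (boolP (e \in S)) => eS /=; first by rewrite (subsetP ST) // if_same.
by case: (boolP (e \in T)) => eT; rewrite ?if_same // (subsetP TU).
Qed.

Lemma expect_score_score M S T : S \subset upper n -> T \subset upper n ->
    (forall e, e \in upper n -> 0 < M e.1 e.2 < 1) ->
  expect M (fun A => (\prod_(e in S) score M e (A e.1 e.2)) *
                     \prod_(e in T) score M e (A e.1 e.2)) =
  if S == T then \prod_(e in S) (M e.1 e.2 * (1 - M e.1 e.2))^-1 else 0.
Proof.
move=> SU TU M01; rewrite (@expect_prod2 M S T (score M) (score M)) //=.
rewrite (eq_bigr (fun e => if (e \in S) == (e \in T) then
    if e \in S then (M e.1 e.2 * (1 - M e.1 e.2))^-1 else 1 else 0))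
  => [|e /M01/andP[M0 M1]]; last first.
  have MN0 : M e.1 e.2 != 0 by rewrite gt_eqF.
  have MN1 : 1 - M e.1 e.2 != 0 by rewrite gt_eqF // subr_gt0.
  by rewrite /score; case: (e \in S); case: (e \in T); rewrite /=; field; rewrite ?MN0 ?MN1.
case: eqP => [<-|/eqP ST].
  rewrite [LHS]big_mkcond [RHS]big_mkcond; apply: eq_bigr => e _; rewrite eqxx.
  by case: (boolP (e \in S)) => eS; rewrite ?if_same // (subsetP SU).
have [e] : exists e, (e \in S) != (e \in T).
  apply/existsP; apply: contraNT ST => /existsPn eST.
  by apply/eqP/setP => e; apply/eqP/negPn/eST.
move=> eST; rewrite (bigD1 e) /= ?(negbTE eST) ?mul0r //.
move: eST; case: (boolP (e \in S)) => [/(subsetP SU) //|_].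
by case: (boolP (e \in T)) => [/(subsetP TU) //|_].
Qed.

End Observation.

(** * Risk of one entry *)

Lemma natr_forall (R : comNzSemiRingType) (I : finType) (P : pred I) (b : I -> bool) :
  \prod_(i | P i) (b i)%:R = [forall (i | P i), b i]%:R :> R.
Proof.
have [/forallP allb|/forallPn[i]] := boolP [forall (i | P i), b i].
  by rewrite big1 // => i Pi; have := allb i; rewrite Pi => /= ->.
by rewrite negb_imply => /andP[Pi bi]; rewrite (bigD1 i) //= (negbTE bi) mul0r.
Qed.

(** On a symmetric 0/1 matrix with zero diagonal every monomial becomes square-free in the entries
    above the diagonal: exponents collapse to 1, lower entries fold onto upper ones, and diagonal
    entries give 0. None of this raises the degree. *)
Lemma meval_adjacency (R : realType) (n D : nat) (p : mpoly (n * n) R) :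
    (mmeasure mdeg p <= D.+1)%N ->
  exists (c : multinom (n * n) -> R) (T : multinom (n * n) -> {set 'I_n * 'I_n}),
    (forall m, m \in msupp p -> T m \subset upper n /\ (#|T m| <= D)%N) /\
    forall A : 'M[bool]_n, is_adjacency A ->
      meval (fun l => mxvec (map_mx (fun b : bool => b%:R) A) 0 l) p =
      \sum_(m <- msupp p) c m * \prod_(e in T m) (A e.1 e.2)%:R.
Proof.
move=> degp.
have [ij ijP] : exists ij : 'I_(n * n) -> 'I_n * 'I_n,
    forall l, l = mxvec_index (ij l).1 (ij l).2.
  apply: (@fin_all_exists _ _ (fun l ij => l = mxvec_index ij.1 ij.2)) => l.
  by case/mxvec_indexP: l => i j; exists (i, j).
pose edge l : 'I_n * 'I_n :=
  if ((ij l).1 < (ij l).2)%N then ij l else ((ij l).2, (ij l).1).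
pose supp (m : multinom (n * n)) : {set 'I_(n * n)} := [set l | m l != 0%N].
pose loopless m := [forall l in supp m, (ij l).1 != (ij l).2].
(* The loopless factor cancels monomials containing a diagonal entry; intersecting with [upper n]
   keeps their edge sets within range. *)
exists (fun m => mcoeff m p * (loopless m)%:R), (fun m => (edge @: supp m) :&: upper n).
split=> [m mp|A /andP[/eqP AT /forallP A0]].
  split; first exact: subsetIr.
  apply: (leq_trans (subset_leq_card (subsetIl _ _))).
  apply: (leq_trans (leq_imset_card _ _)).
  rewrite -ltnS; apply: leq_trans degp; apply: leq_ltn_trans (msize_mdeg_lt mp).
  rewrite mdegE -sum1_card big_mkcond; apply: leq_sum => l _.
  by rewrite inE; case: (m l).
rewrite mevalE; apply: eq_bigr => m _; rewrite -mulrA; congr (_ * _).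
have valE l : mxvec (map_mx (fun b : bool => b%:R) A) 0 l = (A (ij l).1 (ij l).2)%:R :> R.
  by rewrite {1}(ijP l) mxvecE mxE.
have edgeE l : A (edge l).1 (edge l).2 = A (ij l).1 (ij l).2.
  by rewrite /edge; case: ifP => //= _; rewrite -{1}AT mxE.
have -> : \prod_l mxvec (map_mx (fun b : bool => b%:R) A) 0 l ^+ m l =
    \prod_(l in supp m) (A (edge l).1 (edge l).2)%:R :> R.
  rewrite [RHS]big_mkcond; apply: eq_bigr => l _; rewrite valE edgeE inE.
  case: (m l) => //= d; by case: (A _ _); rewrite ?expr1n ?expr0n.
rewrite !natr_forall -natrM mulnb; congr (nat_of_bool _)%:R.
apply/forall_inP/andP => [all_A|[noloop all_A] l lm].
  split.
    apply/forall_inP => l lm; apply: contraTneq (all_A l lm) => ij12.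
    by rewrite edgeE ij12 A0.
  by apply/forall_inP => e; rewrite in_setI => /andP[/imsetP[l lm ->] _]; exact: all_A.
have ij12 := forall_inP noloop l lm.
have eU : edge l \in upper n.
  rewrite inE /edge; case: ifP => //= ltF.
  by rewrite ltn_neqAle leqNgt ltF andbT eq_sym.
by apply: (forall_inP all_A); rewrite in_setI eU andbT imset_f.
Qed.

(** * The two-level prior and the joint law of labels and graph *)

Section TwoLevelPrior.
Variables (R : realType) (n k : nat).
Hypothesis k_gt0 : (0 < k)%N.
Variable lam : R.
Hypotheses (lam_ge0 : 0 <= lam) (lam_le : lam <= 1 / 2).
Implicit Types (z : {ffun 'I_n -> 'I_k}) (e : 'I_n * 'I_n).

Let K_gt0 : (0 < #|'I_k|)%N. Proof. by rewrite card_ord. Qed.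

Definition sbm_of z : 'M[R]_n :=
  \matrix_(i, j) if i == j then 0 else 1 / 4 + lam * (z i == z j)%:R.

Lemma sbm_of_upper z e : e \in upper n ->
  sbm_of z e.1 e.2 = 1 / 4 + signal lam z e.
Proof.
by rewrite inE mxE /signal /mono -val_eqE /= => /ltn_eqF ->.
Qed.

Lemma signal_le z e : signal lam z e <= 1 / 2.
Proof. by apply: le_trans lam_le; rewrite ler_piMr // mono_le1. Qed.

Lemma sbm_of_SBM z : SBM R n k (sbm_of z).
Proof.
have lamb (b : bool) : 0 <= 1 / 4 + lam * b%:R <= 1.
  have [? ?] := (lam_ge0, lam_le).
  by case: b => /=; rewrite ?mulr1n ?mulr1 ?mulr0n ?mulr0; apply/andP; split; lra.
split; first by move=> i j; rewrite mxE; case: ifP => _; rewrite ?lexx ?ler01.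
split; first by move=> i; rewrite mxE eqxx.
exists (\matrix_(a, b) (1 / 4 + lam * (a == b)%:R)), z; split.
- by apply/matrixP => a b; rewrite !mxE eq_sym.
- by move=> a b; rewrite mxE.
- by move=> i j ij; rewrite !mxE [j == i]eq_sym (negbTE ij) [z j == _]eq_sym.
Qed.

Lemma sbm_of01 z i j : 0 <= sbm_of z i j <= 1.
Proof. by case: (sbm_of_SBM z). Qed.

Lemma sbm_of_inner z e : e \in upper n -> 1 / 4 <= sbm_of z e.1 e.2 <= 3 / 4.
Proof.
move=> eU; rewrite sbm_of_upper //.
by have := signal_le z e; have := signal_ge0 lam_ge0 z e; move=> *; apply/andP; split; lra.
Qed.

Lemma sbm_of_inner_lt z e : e \in upper n -> 0 < sbm_of z e.1 e.2 < 1.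
Proof. by move=> /(sbm_of_inner z)/andP[? ?]; apply/andP; split; lra. Qed.

Definition joint (F : {ffun 'I_n -> 'I_k} -> 'M[bool]_n -> R) : R :=
  unif (fun z => expect (sbm_of z) (F z)).

Lemma jointD F G : joint (fun z A => F z A + G z A) = joint F + joint G.
Proof. by rewrite /joint -unifD; apply: eq_unif => z; rewrite expectD. Qed.

Lemma jointZ (a : R) F : joint (fun z A => a * F z A) = a * joint F.
Proof. by rewrite /joint -unifZ; apply: eq_unif => z; rewrite expectZ. Qed.

Lemma joint_sum (J : Type) (r : seq J) (P : pred J) F :
  joint (fun z A => \sum_(j <- r | P j) F j z A) = \sum_(j <- r | P j) joint (F j).
Proof. by rewrite /joint -unif_sum; apply: eq_unif => z; rewrite expect_sum. Qed.

Lemma eq_joint F G : (forall z A, is_adjacency A -> F z A = G z A) ->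
  joint F = joint G.
Proof. by move=> FG; apply: eq_unif => z; apply: eq_expect => A; apply: FG. Qed.

Lemma joint_ge0 F : (forall z A, 0 <= F z A) -> 0 <= joint F.
Proof.
move=> F0; apply: unif_ge0 => // z; rewrite -(expect_cst (sbm_of z) 0).
by apply: ler_expect => // i j; apply: sbm_of01.
Qed.

(** * Low-degree lower bound for one fixed pair *)

Section Entry.
Variables (D : nat) (e0 : 'I_n * 'I_n).
Hypotheses (D_gt0 : (0 < D)%N) (e0_upper : e0 \in upper n).

Let e0_neq : e0.1 != e0.2.
Proof. by move: e0_upper; rewrite inE -val_eqE /= => /ltn_eqF ->. Qed.

Local Notation kap := (kappa 'I_k lam e0).
Local Notation small S := ((S \subset upper n) && (#|S| <= D)%N).

(** This may depend on the hidden labels as well as on the graph, since it serves only as a dual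
    certificate and not as an estimator. *)
Definition witness z (A : 'M[bool]_n) : R :=
  \sum_(S : {set 'I_n * 'I_n} | small S) kap S * \prod_(e in S) score (sbm_of z) e (A e.1 e.2).

Lemma expect_centered z (T : {set 'I_n * 'I_n}) (p : R) : T \subset upper n ->
  expect (sbm_of z) (fun A => \prod_(e in T) ((A e.1 e.2)%:R - p)) =
  \prod_(e in T) (sbm_of z e.1 e.2 - p).
Proof.
move=> TU.
have := expect_score_centered p (sub0set (upper n)) TU (@sbm_of_inner_lt z).
rewrite sub0set setD0 => <-.
by apply: eq_expect => A _; rewrite big_set0 mul1r.
Qed.

(** By [expect_score_centered] only subsets S of T correlate, each with coefficient [mom (T :\: S)],
    so the claim is the relation [sum_cumul]. As |T| <= D, the truncation in [witness] loses none of
    them. *)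
Lemma witness_centered (T : {set 'I_n * 'I_n}) : T \subset upper n -> (#|T| <= D)%N ->
  joint (fun z A => (witness z A - signal lam z e0) *
                    \prod_(e in T) ((A e.1 e.2)%:R - 1 / 4)) = 0.
Proof.
move=> TU TD.
have -> : joint (fun z A => (witness z A - signal lam z e0) *
                    \prod_(e in T) ((A e.1 e.2)%:R - 1 / 4)) =
  joint (fun z A => \sum_(S : {set 'I_n * 'I_n} | small S) kap S *
    ((\prod_(e in S) score (sbm_of z) e (A e.1 e.2)) * 
     \prod_(e in T) ((A e.1 e.2)%:R - 1 / 4))) - tgt 'I_k lam e0 T.
  rewrite /tgt -[X in _ = _ + X]mulN1r -unifZ /joint -unifD; apply: eq_unif => z.
  have -> : \prod_(e in T) signal lam z e =
      expect (sbm_of z) (fun A => \prod_(e in T) ((A e.1 e.2)%:R - 1 / 4)).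
    rewrite expect_centered //; apply: eq_bigr => e eT.
    by rewrite sbm_of_upper ?(subsetP TU) // addrC addKr.
  rewrite mulrA -expectZ -expectD; apply: eq_expect => A _.
  rewrite mulrBl mulN1r mulNr; congr (_ - _); rewrite mulr_suml.
  by apply: eq_bigr => S _; rewrite mulrA.
apply/eqP; rewrite subr_eq0; apply/eqP.
rewrite -(sum_cumul (tgt 'I_k lam e0) (mom0 _ K_gt0 lam)) joint_sum.
rewrite (bigID (fun S : {set 'I_n * 'I_n} => S \subset T)) /= [X in _ + X]big1 ?addr0; last first.
  move=> S /andP[/andP[SU _] NST]; rewrite jointZ.
  rewrite /joint -[RHS](mulr0 (kap S)); congr (_ * _).
  rewrite -[RHS](unif_cst 'I_n K_gt0 0); apply: eq_unif => z.
  by rewrite expect_score_centered // ?(negbTE NST) //; apply: sbm_of_inner_lt.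
apply: eq_big => S.
  case: (boolP (S \subset T)) => ST; rewrite ?andbF // andbT.
  by rewrite (subset_trans ST TU) (leq_trans (subset_leq_card ST) TD).
move=> /andP[/andP[SU _] ST]; rewrite jointZ; congr (_ * _); apply: eq_unif => z.
rewrite expect_score_centered // ?ST; last exact: sbm_of_inner_lt.
apply: eq_bigr => e; rewrite in_setD => /andP[_ eT].
by rewrite sbm_of_upper ?(subsetP TU) // addrC addKr.
Qed.

Lemma witness_monomial (T : {set 'I_n * 'I_n}) : T \subset upper n -> (#|T| <= D)%N ->
  joint (fun z A => (witness z A - signal lam z e0) * \prod_(e in T) (A e.1 e.2)%:R) = 0.
Proof.
move=> TU TD.
transitivity (joint (fun z A => \sum_(S : {set 'I_n * 'I_n} | S \subset T)
    (\prod_(e in T :\: S) (1 / 4)) * ((witness z A - signal lam z e0) *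
    \prod_(e in S) ((A e.1 e.2)%:R - 1 / 4)))).
  apply: eq_joint => z A _.
  transitivity ((witness z A - signal lam z e0) *
      \prod_(e in T) (((A e.1 e.2)%:R - 1 / 4) + 1 / 4)).
    by congr (_ * _); apply: eq_bigr => e _; rewrite subrK.
  rewrite prodrD_subsets mulr_sumr; apply: eq_bigr => S _.
  by rewrite mulrA mulrC.
rewrite joint_sum big1 // => S ST; rewrite jointZ witness_centered ?mulr0 //.
  exact: subset_trans ST TU.
exact: leq_trans (subset_leq_card ST) TD.
Qed.

Lemma joint_witness_sqr :
  joint (fun z A => witness z A ^+ 2) <=
  \sum_(S : {set 'I_n * 'I_n} | (#|S| <= D)%N) kap S ^+ 2 * (16 / 3) ^+ #|S|.
Proof.
apply: (@le_trans _ _ (\sum_(S : {set 'I_n * 'I_n} | small S) kap S ^+ 2 * (16 / 3) ^+ #|S|)); last first.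
  rewrite big_mkcond [leRHS]big_mkcond; apply: ler_sum => S _.
  by case: (S \subset upper n) => //=; case: ifP => // _; rewrite mulr_ge0 ?sqr_ge0 ?exprn_ge0.
rewrite -[leRHS](unif_cst 'I_n K_gt0); apply: ler_unif => // z.
have -> : expect (sbm_of z) (fun A => witness z A ^+ 2) =
    expect (sbm_of z) (fun A => \sum_(S : {set 'I_n * 'I_n} | small S)
      \sum_(T : {set 'I_n * 'I_n} | small T) (kap S * kap T) *
      ((\prod_(e in S) score (sbm_of z) e (A e.1 e.2)) *
        \prod_(e in T) score (sbm_of z) e (A e.1 e.2))).
  apply: eq_expect => A _; rewrite expr2 /witness big_distrlr /=.
  by apply: eq_bigr => S _; apply: eq_bigr => T _; rewrite mulrACA.
rewrite expect_sum; apply: ler_sum => S smS; have [SU _] := andP smS.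
rewrite expect_sum (bigD1 S) //= big1 => [|T /andP[/andP[TU _] TS]]; last first.
  rewrite expectZ expect_score_score ?[S == T]eq_sym ?(negbTE TS) ?mulr0 //.
  exact: sbm_of_inner_lt.
rewrite addr0 expectZ expect_score_score ?eqxx //; last exact: sbm_of_inner_lt.
rewrite -expr2 ler_wpM2l ?sqr_ge0 // -prodr_const; apply: ler_prod => e eS.
have /andP[M1 M3] := sbm_of_inner z (subsetP SU e eS).
(* The Bernoulli variance on [1/4, 3/4] is smallest at the endpoints; this is where 16/3 comes
   from. *)
have M0 : 3 / 16 <= sbm_of z e.1 e.2 * (1 - sbm_of z e.1 e.2).
  have : 0 <= (sbm_of z e.1 e.2 - 1 / 4) * (3 / 4 - sbm_of z e.1 e.2).
    by rewrite mulr_ge0 ?subr_ge0.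
  by move: (sbm_of z e.1 e.2) => m; lra.
have vgt0 : 0 < sbm_of z e.1 e.2 * (1 - sbm_of z e.1 e.2) by lra.
rewrite invr_ge0 ltW //=.
rewrite (_ : 16 / 3 = (3 / 16)^-1); last by rewrite invf_div.
by rewrite lef_pV2 ?posrE //; lra.
Qed.

Lemma joint_signal_sqr : joint (fun z _ => signal lam z e0 ^+ 2) = lam ^+ 2 / k%:R.
Proof.
transitivity (unif (fun z : {ffun 'I_n -> 'I_k} => lam ^+ 2 * (1 * (z e0.1 == z e0.2)%:R)) : R).
  apply: eq_unif => z; rewrite expect_cst /signal /mono exprMn mul1r; congr (_ * _).
  by case: (_ == _); rewrite ?expr1n ?expr0n.
by rewrite unifZ unif_match // unif_cst // card_ord mul1r.
Qed.

Lemma entry_risk (eps : R) (p : mpoly (n * n) R) : (1 < k)%N -> 0 <= eps ->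
    lam ^+ 2 <= eps -> n%:R * (lam ^+ 2 * k%:R ^- 2) <= eps ->
    32 * (16 / 3) * eps * D%:R ^+ 4 <= 1 / 3 -> (mmeasure mdeg p <= D.+1)%N ->
  lam ^+ 2 / (4 * k%:R) <=
  joint (fun z A => (meval (fun l => mxvec (map_mx (fun b : bool => b%:R) A) 0 l) p -
                     sbm_of z e0.1 e0.2) ^+ 2).
Proof.
move=> k_gt1 eps0 lam_eps lamn_eps eps_small degp.
have [c [T [Tsmall evalE]]] := meval_adjacency degp.
pose g (A : 'M[bool]_n) := \sum_(m <- msupp p) c m * \prod_(e in T m) (A e.1 e.2)%:R - 1 / 4 : R.
pose wx z A := witness z A - signal lam z e0.
(* With u the witness and x the signal: (g - x)^2 = (g - u)^2 + 2 (u - x) g + x^2 - u^2, where [g]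
   is the polynomial recentred by 1/4. The cross term has mean zero by [witness_monomial], the
   constant being the empty monomial. *)
have -> : joint (fun z A => (meval (fun l => mxvec (map_mx (fun b : bool => b%:R) A) 0 l) p -
                     sbm_of z e0.1 e0.2) ^+ 2) =
    joint (fun z A => (g A - witness z A) ^+ 2 + (2 * (wx z A * g A) +
      (signal lam z e0 ^+ 2 + (-1) * witness z A ^+ 2))).
  apply: eq_joint => z A adjA; rewrite evalE // sbm_of_upper // /wx /g.
  by ring.
rewrite jointD jointD jointZ jointD jointZ joint_signal_sqr.
have -> : joint (fun z A => wx z A * g A) = 0.
  transitivity (joint (fun z A => \sum_(m <- msupp p) c m *
      (wx z A * \prod_(e in T m) (A e.1 e.2)%:R) +
      (- (1 / 4)) * (wx z A * \prod_(e in set0) (A e.1 e.2)%:R))).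
    apply: eq_joint => z A _; rewrite /g big_set0 mulr1 mulrBr mulr_sumr mulNr [1 / 4 * _]mulrC.
    by congr (_ - _); apply: eq_bigr => m _; rewrite mulrCA.
  rewrite jointD jointZ witness_monomial ?sub0set ?cards0 // mulr0 addr0.
  rewrite joint_sum big_seq big1 // => m mp; rewrite jointZ.
  by have [TU TD] := Tsmall m mp; rewrite witness_monomial ?mulr0.
have := joint_ge0 (fun z A => sqr_ge0 (g A - witness z A)).
have := joint_witness_sqr.
have := @kappa_energy R 'I_n 'I_k K_gt0 lam e0 lam_ge0 e0_neq D (16 / 3) eps D_gt0.
rewrite !card_ord => /(_ _ eps0 lam_eps lamn_eps eps_small) energy.
have {energy} := energy (ltac:(lra)).
set W := joint _; set V := \sum_(_ | _) _; set G := joint _.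
move=> VE WV G0.
have k2 : 2 <= k%:R :> R by rewrite ler_nat.
have k0 : 0 < k%:R :> R by rewrite ltr0n.
(* Here k >= 2 enters: the witness takes at most 3/4 of the signal energy lam^2 / k, leaving a
   quarter. *)
have : 3 / 2 * (lam / k%:R) ^+ 2 <= 3 / 4 * (lam ^+ 2 / k%:R).
  have -> : 3 / 2 * (lam / k%:R) ^+ 2 = 3 / 4 * (lam ^+ 2 / k%:R * (2 / k%:R)).
    by field; rewrite gt_eqF.
  rewrite ler_wpM2l ?ler_piMr ?divr_ge0 ?exprn_ge0 ?ler0n //.
  by rewrite ler_pdivrMr // mul1r.
have -> : lam ^+ 2 / (4 * k%:R) = 1 / 4 * (lam ^+ 2 / k%:R) by field; rewrite gt_eqF.
by move=> *; lra.
Qed.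

End Entry.
End TwoLevelPrior.

(** * Risk of the matrix *)

Lemma sum_upper (R : realType) (n : nat) (a : R) :
  \sum_(i < n) \sum_(j < n | (i < j)%N) a = 'C(n, 2)%:R * a.
Proof.
rewrite (exchange_big_dep xpredT) //= -bin2_sum big_mkord natr_sum mulr_suml.
apply: eq_bigr => j _; rewrite -(big_ord_widen n (fun=> a) (ltnW (ltn_ord j))).
by rewrite sumr_const card_ord mulr_natl.
Qed.

(** The loss is the mean over pairs and each pair obeys the same Bayes bound [entry_risk], so the
    average risk does too; some labelling then reaches it. *)
Lemma sbm_risk_ge (R : realType) (n k D : nat) (lam eps : R) (Mhat : poly_estimator R n) :
    (1 < n)%N -> (1 < k)%N -> (0 < D)%N -> 0 <= lam -> lam <= 1 / 2 -> 0 <= eps ->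
    lam ^+ 2 <= eps -> n%:R * (lam ^+ 2 * k%:R ^- 2) <= eps ->
    32 * (16 / 3) * eps * D%:R ^+ 4 <= 1 / 3 -> degree_le R n D Mhat ->
  exists2 M, SBM R n k M & lam ^+ 2 / (4 * k%:R) <= risk Mhat M.
Proof.
move=> n_gt1 k_gt1 D_gt0 lam0 lam_le eps0 lam_eps lamn_eps eps_small degM.
have k_gt0 := ltnW k_gt1.
have K_gt0 : (0 < #|'I_k|)%N by rewrite card_ord.
have C0 : 0 < 'C(n, 2)%:R :> R by rewrite ltr0n bin_gt0.
suff /(unif_exists K_gt0)[z riskz] : lam ^+ 2 / (4 * k%:R) <=
    unif (fun z : {ffun 'I_n -> 'I_k} => risk Mhat (sbm_of lam z)).
  by exists (sbm_of lam z) => //; apply: sbm_of_SBM.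
have -> : unif (fun z : {ffun 'I_n -> 'I_k} => risk Mhat (sbm_of lam z)) =
    ('C(n, 2)%:R)^-1 * \sum_(i < n) \sum_(j < n | (i < j)%N)
    joint lam (fun (z : {ffun 'I_n -> 'I_k}) A =>
      (meval (fun l => mxvec (map_mx (fun b : bool => b%:R) A) 0 l) (Mhat i j) -
       sbm_of lam z i j) ^+ 2).
  under [X in _ = _ * X]eq_bigr do rewrite -joint_sum.
  rewrite -joint_sum -jointZ; apply: eq_unif => z; apply: eq_expect => A _.
  congr (_ * _); apply: eq_bigr => i _; apply: eq_bigr => j _.
  by rewrite /estimate mxE.
rewrite ler_pdivlMl // -sum_upper.
apply: ler_sum => i _; apply: ler_sum => j ij.
by apply: (@entry_risk R n k k_gt0 lam lam0 lam_le D (i, j) D_gt0 _ eps) => //; rewrite inE.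
Qed.

Theorem theorem1 (R : realType) :
  exists c : R, 0 < c /\
    forall n k D : nat,
      (0 < n)%N -> (2 <= k)%N -> k%:R <= Num.sqrt (n%:R : R) -> (1 <= D)%N ->
      ((c * k%:R / (n%:R * D%:R ^+ 4))%:E <= minimax_risk R n k D)%E.
Proof.
(* The constant is 1 / (4 * 32^2), read off from [lam ^+ 2 / (4 * k%:R)] for the [lam] chosen
   below. *)
exists (1 / 4096); split; first by lra.
move=> n k D n0 k2 ksqrt D1.
set s := Num.sqrt _ in ksqrt.
have s2 : s ^+ 2 = n%:R by rewrite sqr_sqrtr.
have k2R : 2 <= k%:R :> R by rewrite ler_nat.
have D1R : 1 <= D%:R :> R by rewrite ler1n.
have s0 : 0 < s by lra.
have sN0 : s != 0 by rewrite gt_eqF.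
have kN0 : k%:R != 0 :> R by rewrite gt_eqF //; lra.
have DN0 : D%:R != 0 :> R by rewrite gt_eqF //; lra.
have n_gt1 : (1 < n)%N by rewrite -(ltr_nat R) -s2; nra.
(* This makes n lam^2 / k^2 equal to [eps], and then k <= sqrt n gives lam^2 <= [eps]. The D^4 in
   [eps] offsets the factor D^4 in the ratio of the geometric series. *)
pose lam := k%:R / (32 * D%:R ^+ 2 * s).
pose eps : R := 1 / (1024 * D%:R ^+ 4).
have D4_ge1 : 1 <= D%:R ^+ 4 :> R by rewrite exprn_ege1.
have D4 : 0 < D%:R ^+ 4 :> R by lra.
have lam0 : 0 <= lam by rewrite divr_ge0 ?mulr_ge0 ?ler0n ?(ltW s0).
have ks1 : 0 <= k%:R / s <= 1.
  by rewrite ler_pdivrMr // mul1r ksqrt divr_ge0 // ltW.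
have eps0 : 0 <= eps by rewrite divr_ge0 ?ler01 ?mulr_ge0 ?ler0n ?(ltW D4).
have lamE : lam ^+ 2 = (k%:R / s) ^+ 2 * eps.
  by rewrite /lam /eps; field; rewrite sN0 DN0.
have lam_eps : lam ^+ 2 <= eps.
  by case/andP: ks1 => *; rewrite lamE ler_piMl // exprn_ile1.
have lamn : n%:R * (lam ^+ 2 * k%:R ^- 2) = eps.
  by rewrite lamE -s2; field; rewrite sN0 kN0.
have epsE : 32 * (16 / 3) * eps * D%:R ^+ 4 = 1 / 6 by rewrite /eps; field.
have eps_le : eps <= 1 / 4.
  rewrite /eps ler_pdivrMr; last by rewrite mulr_gt0 ?ltr0n.
  by lra.
have lam_half : lam <= 1 / 2 by nra.
apply: le_ereal_inf_tmp => _ [Mhat degM <-].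
have [||M MSBM riskM] := @sbm_risk_ge R n k D lam eps Mhat n_gt1 k2 D1 lam0 lam_half
  eps0 lam_eps _ _ degM.
- by rewrite lamn.
- by rewrite epsE; lra.
apply: (@le_trans _ _ (risk Mhat M)%:E); last by apply: ereal_sup_ubound; exists M.
rewrite lee_fin; apply: le_trans riskM.
rewrite le_eqVlt; apply/orP; left; apply/eqP; rewrite lamE -s2 /eps.
by field; rewrite sN0 kN0 DN0.
Qed.
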